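(* Let $\mathcal B$ be a Golomb system and $\kappa$ a Kirch function for $\mathcal B$. The spaces $(\mathbb Z,\mathcal T_{\mathcal B,\kappa})$ and $(\mathbb N_1,\mathcal T_{\mathcal B,\kappa})$ are locally connected if and only if $\kappa(p)<\infty$ holds for every prime $p$. Moreover, if this happens then they are locally superconnected.
   Context: Notation: $\mathbb N=\{0,1,2,\dots\}$, $\mathbb N_1=\mathbb N-\{0\}$, $\mathcal P$ is the set of prime numbers, $v_p$ the $p$-adic valuation; $[a]_n$ is the class of $a$ in $\mathbb Z/n\mathbb Z$; for $n\mid m$, $\pi_n^m\colon\mathbb Z/m\mathbb Z\to\mathbb Z/n\mathbb Z$ is the natural projection. Golomb system: fix $\gamma\colon\mathcal P\to\mathbb N$ and, for each prime $p$, a nonempty subset $B_{p^{\gamma(p)}}\subseteq\mathbb Z/p^{\gamma(p)}\mathbb Z$, with $B_{p^{\gamma(p)}}\neq\mathbb Z/p^{\gamma(p)}\mathbb Z$ if $\gamma(p)>0$. Define $B_n\subseteq\mathbb Z/n\mathbb Z$ for all $n\in\mathbb N_1$ by: $B_1=\mathbb Z/1\mathbb Z$; $B_{p^r}=(\pi_{p^{\gamma(p)}}^{p^r})^{-1}(B_{p^{\gamma(p)}})$ if $r\ge\gamma(p)$; $B_{p^r}=\pi_{p^r}^{p^{\gamma(p)}}(B_{p^{\gamma(p)}})$ if $r<\gamma(p)$; and $B_n=\bigcap_{p\mid n}(\pi^n_{p^{v_p(n)}})^{-1}(B_{p^{v_p(n)}})$ in general. The family $\mathcal B=\{B_n\}_{n\in\mathbb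 N_1}$ is called a Golomb system. It is always assumed that $\gamma(p)$ is the smallest value giving rise to $\mathcal B$, i.e. the smallest $r$ such that $B_{p^s}=(\pi_{p^r}^{p^s})^{-1}(B_{p^r})$ for all $s\ge r$. A Kirch function for $\mathcal B$ is a map $\kappa\colon\mathcal P\to\mathbb N\cup\{\infty\}$ with $\gamma(p)\le\kappa(p)$ for every $p$; it is always assumed that $\kappa(p)=0$ if $\gamma(p)=0$. The topology $\mathcal T_{\mathcal B,\kappa}$ on $\mathbb Z$ has as subbase the cosets $a+p^r\mathbb Z$ with $a\in\mathbb Z$, $p\in\mathcal P$, $r\in\mathbb N$, $\gamma(p)\le r\le\kappa(p)$ and $[a]_{p^r}\notin B_{p^r}$. On $\mathbb N_1$ the subspace topology is taken. A topological space $X$ is superconnected if for any $r\in\mathbb N_1$ and any nonempty open subsets $U_1,\dots,U_r$ of $X$ one has $\bigcap_i\overline{U_i}\ne\emptyset$ (closures in $X$). Locally connected (respectively, locally superconnected) means that every point has a base of neighbourhoods consisting of connected (respectively, superconnected) open sets. *)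

(* Defs.v *)
From HB Require Import structures.
From mathcomp Require Import all_boot all_order all_algebra.
From mathcomp Require Import all_classical topology.

Set Implicit Arguments.
Unset Strict Implicit.
Unset Printing Implicit Defensive.

Import Order.TTheory GRing.Theory Num.Theory.

Local Open Scope classical_set_scope.
Local Open Scope nat_scope.

(* Z/nZ, represented by 0, ..., n-1; only meaningful for n > 0.  'Z_n is not
   usable here, because 'Z_1 has two elements and the modulus p ^ r may be 1. *)
Definition residue (n : nat) : finType := 'I_n.-1.+1.

Definition residue_class (n : nat) (a : int) : residue n := inZp `|(a %% n)%Z|.

(* Only meaningful for n dividing m. *)
Definition residue_proj (m n : nat) (x : residue m) : residue n := inZp (val x).

Section GolombFamily.
Variables (gamma : nat -> nat) (base : forall p, {set residue (p ^ gamma p)}).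

Definition primary_set (p r : nat) : {set residue (p ^ r)} :=
  if gamma p <= r then @residue_proj (p ^ r) (p ^ gamma p) @^-1: base p
  else @residue_proj (p ^ gamma p) (p ^ r) @: base p.

Definition golomb_set (n : nat) : {set residue n} :=
  [set x | all (fun p => residue_proj (p ^ logn p n) x
                           \in primary_set p (logn p n)) (primes n)].

(* For r = 0 both sides are the whole of Z/1Z, whence the nonemptiness
   hypothesis. *)
Lemma golomb_set_primary (p r : nat) :
  prime p -> base p != finset.set0 -> golomb_set (p ^ r) = primary_set p r.
Proof.
move=> p_pr base_n0; apply/setP => x; rewrite inE.
have proj_id n (y : residue n) : residue_proj n y = y.
  by apply: val_inj; rewrite /= modn_small.
have residue1 n (u v : residue n) : n = 1 -> u = v.
  by move=> n1; subst n; rewrite [u]ord1 [v]ord1.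
case: r x => [|r] x.
  rewrite /= /primary_set; have [b bB] := set0Pn _ base_n0.
  case: ifPn => [|_]; last first.
    by symmetry; apply/imsetP; exists b => //; exact: (residue1 (p ^ 0)).
  rewrite leqn0 inE => /eqP g0.
  by rewrite (residue1 (p ^ gamma p) (residue_proj _ x) b) // g0.
by rewrite primesX // primes_prime //= andbT pfactorK // proj_id.
Qed.

End GolombFamily.

(* Only the values of gamma and base at primes matter. *)
Record golomb_system := GolombSystem {
  gamma : nat -> nat;
  base : forall p, {set residue (p ^ gamma p)};
  base_neq0 : forall p, prime p -> base p != finset.set0;
  base_neqT : forall p, prime p -> 0 < gamma p -> base p != finset.setT;
  gamma_min : forall p r, prime p ->
    (forall s, r <= s -> golomb_set base (p ^ s) =
       @residue_proj (p ^ s) (p ^ r) @^-1: golomb_set base (p ^ r)) ->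
    gamma p <= r
}.

(* An element of N u {oo}, with None standing for oo. *)
Definition natbar := option nat.

Definition le_natbar (r : nat) (k : natbar) : bool :=
  if k is Some m then r <= m else true.

Record kirch_function (B : golomb_system) := KirchFunction {
  kappa :> nat -> natbar;
  gamma_le_kappa : forall p, prime p -> le_natbar (gamma B p) (kappa p);
  kappa_eq0 : forall p, prime p -> gamma B p = 0 -> kappa p = Some 0
}.

Definition coset (a : int) (n : nat) : set int :=
  [set x | exists z : int, x = (a + n%:Z * z)%R].

Definition golomb_kirch_space (B : golomb_system) (kap : kirch_function B) :
  Type := int.

Definition golomb_kirch_subbase (B : golomb_system) (kap : kirch_function B) :
    set (set (golomb_kirch_space kap)) :=
  [set U | exists (a : int) (p r : nat),
     [/\ prime p, gamma B p <= r, le_natbar r (kap p),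
         residue_class (p ^ r) a \notin golomb_set (base B) (p ^ r) &
         U = coset a (p ^ r)]].
Arguments golomb_kirch_subbase {B} kap.

HB.instance Definition _ (B : golomb_system) (kap : kirch_function B) :=
  Choice.copy (golomb_kirch_space kap) int.
HB.instance Definition _ (B : golomb_system) (kap : kirch_function B) :=
  isSubBaseTopological.Build (golomb_kirch_space kap)
    (golomb_kirch_subbase kap) id.

(* Coerced to a type, this set carries the subspace topology. *)
Definition positive_part (B : golomb_system) (kap : kirch_function B) :
    set (golomb_kirch_space kap) :=
  [set x : int | (0 < x)%R].
Arguments positive_part {B} kap.

Definition superconnected (X : topologicalType) : Prop :=
  forall (r : nat) (U : 'I_r -> set X), 0 < r ->
    (forall i, open (U i) /\ U i !=set0) ->
    \bigcap_i closure (U i) !=set0.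

Definition has_open_nbhs_base (X : topologicalType) (P : set X -> Prop) :=
  forall (x : X) (U : set X), nbhs x U ->
    exists V : set X, [/\ open V, V x, V `<=` U & P V].

Definition locally_connected (X : topologicalType) : Prop :=
  has_open_nbhs_base (@connected X).

Definition locally_superconnected (X : topologicalType) : Prop :=
  has_open_nbhs_base (fun V : set X => superconnected (set_type V)).

(* Main.v *)
Require Import Defs.
From mathcomp Require Import all_boot all_order all_algebra.
From mathcomp Require Import all_classical topology.
From mathcomp Require Import finmap.

(** Call a prime [p] good at [x] if the class of [x] modulo [p ^ gamma p] lies
    outside [B], and bad otherwise.  If [kappa] is finite, the least neighbourhood
    of [x] involving only primes below [N] is [core x N], the set of [y] congruent
    to [x] modulo [p ^ kappa p] for every [p < N] good at [x].  It is
    superconnected: given open subsets of it around [a_1, ..., a_r], the Chinese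
    remainder theorem gives a [y] in [core x N] at which every prime constraining
    some [a_i] but not [x] is bad; then neighbourhoods of [y] and of [a_i] only
    share congruences that both inherit from [x], so they meet.
    If [kappa p] is infinite, pick [y] good at [p].  Inside the open set
    [y + p ^ gamma p Z] all classes modulo [p ^ s] are clopen, while every
    neighbourhood of [y] contains some [y + n] with [n > 0], and [p ^ s] does not
    divide [n] for large [s]; so no neighbourhood of [y] inside that set is
    connected. *)

Set Implicit Arguments.
Unset Strict Implicit.
Unset Printing Implicit Defensive.

Import Order.TTheory GRing.Theory Num.Theory.

Local Open Scope classical_set_scope.
Local Open Scope nat_scope.

(** * Congruences, residue classes and the Chinese remainder theorem *)

Lemma modz_eq_dvd (m n : nat) (x y : int) :
  m %| n -> (x = y %[mod n])%Z -> (x = y %[mod m])%Z.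
Proof.
move=> mn /eqP; rewrite eqz_mod_dvd => nxy.
by apply/eqP; rewrite eqz_mod_dvd; apply: dvdz_trans nxy.
Qed.

Lemma cosetP (a x : int) (n : nat) : coset a n x <-> (x = a %[mod n])%Z.
Proof.
split=> [[z ->]|/eqP]; first by rewrite addrC mulrC modzMDl.
rewrite eqz_mod_dvd => /dvdzP[z xa]; exists z.
by rewrite mulrC -xa addrC subrK.
Qed.

Lemma residue_class_eq (n : nat) (x y : int) :
  (x = y %[mod n])%Z -> residue_class n x = residue_class n y.
Proof. by rewrite /residue_class => ->. Qed.

Lemma residue_proj_class (m n : nat) (x : int) : 0 < n -> n %| m -> 0 < m ->
  residue_proj n (residue_class m x) = residue_class n x.
Proof.
move=> n0 nm m0; apply: val_inj => /=.
have xm0 k : 0 < k -> (`|(x %% k)%Z|%N : int) = (x %% k)%Z.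
  by move=> k0; rewrite gez0_abs // modz_ge0 // eqz_nat -lt0n.
rewrite !prednK //.
have lt k : 0 < k -> `|(x %% k)%Z| < k.
  by move=> k0; rewrite -ltz_nat xm0 // ltz_pmod // ltz_nat.
rewrite [in LHS](modn_small (lt _ m0)) [in RHS](modn_small (lt _ n0)).
apply/eqP; rewrite -eqz_nat -modz_nat !xm0 //; apply/eqP.
by apply: modz_eq_dvd nm _; rewrite modz_mod.
Qed.

Lemma residue_class_val (n : nat) (b : residue n) :
  0 < n -> residue_class n (val b)%:Z = b.
Proof.
case: n b => [//|n] b _; apply: val_inj => /=; have bn := ltn_ord b.
by rewrite modz_nat absz_nat !modn_small.
Qed.

(** Positivity makes the solution a point of both spaces. *)
Lemma crt_primes (c : nat -> int) (e : nat -> nat) (M : nat) :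
  exists2 y : int, (0 < y)%R &
    forall p, p < M -> prime p -> (y = c p %[mod (p ^ e p)%N])%Z.
Proof.
pose Q M := \prod_(q < M | prime q) q ^ e q.
have Q0 K : 0 < Q K by apply: prodn_cond_gt0 => q qp; rewrite expn_gt0 prime_gt0.
have Qd K p : p < K -> prime p -> p ^ e p %| Q K.
  move=> pK pp; rewrite /Q (bigD1 (Ordinal pK)) //=; exact: dvdn_mulr.
suff [y Hy] : exists y : int, forall p, p < M -> prime p ->
    (y = c p %[mod (p ^ e p)%N])%Z.
  (* Adding a multiple of [Q M] keeps every congruence, and [|y| + 1] copies suffice for positivity
     because [Q M] is at least 1. *)
  exists ((`|y| + 1)%N%:Z * (Q M)%:Z + y)%R.
    have le1 : ((`|y| + 1)%N%:Z <= (`|y| + 1)%N%:Z * (Q M)%:Z :> int)%R.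
      by rewrite -PoszM lez_nat leq_pmulr.
    apply: lt_le_trans (_ : (0 < (`|y| + 1)%N%:Z + y)%R) _; last first.
      by rewrite lerD2r.
    by rewrite PoszD abszE addrAC ltr_wpDl // -lerBlDr sub0r -normrN ler_norm.
  move=> p pM pp; rewrite -(Hy p pM pp).
  apply: modz_eq_dvd (Qd _ _ pM pp) _.
  by rewrite modzMDl.
elim: M => [|M [y Hy]]; first by exists 0%R.
have [pM|pM] := boolP (prime M); last first.
  exists y => p; rewrite ltnS leq_eqVlt => /orP[/eqP->|]; last exact: Hy.
  by move=> pp; rewrite pp in pM.
have cop : coprimez (Q M) (M ^ e M)%N.
  rewrite coprimezE /=; apply: (big_ind (fun z => coprime z _)).
  - exact: coprime1n.
  - by move=> u v cu cv; rewrite coprimeMl cu.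
  - move=> q pq; apply/coprimeXl/coprimeXr.
    rewrite prime_coprime // dvdn_prime2 //; apply/eqP => qM.
    by have := ltn_ord q; rewrite qM ltnn.
exists (zchinese (Q M) (M ^ e M)%N y (c M)) => p.
rewrite ltnS leq_eqVlt => /orP[/eqP-> _|pltM pp].
  exact: zchinese_modr.
rewrite -(Hy p pltM pp); apply: modz_eq_dvd (Qd _ _ pltM pp) _.
exact: zchinese_modl.
Qed.

(** * Superconnected sets and subspaces *)

Lemma superconnected_connected (X : topologicalType) (V : set X) :
  superconnected (set_type V) -> connected V.
Proof.
move=> scV E [x Ex] [C oC EC] [D cD ED]; apply/seteqP; split=> [y|y Vy].
  by rewrite EC => -[].
apply: contrapT => nEy.
(* [P] is the clopen part [E] and [Q] its complement, both seen inside [V]; being disjoint and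
   clopen, they have disjoint closures. *)
pose P : set (set_type V) := set_val @^-1` C.
pose Q : set (set_type V) := set_val @^-1` ~` D.
have oP : open P by exists C.
have oQ : open Q by exists (~` D) => //; exact: closed_openC.
have Vx : V x by move: Ex; rewrite EC => -[].
have Cx : C x by move: Ex; rewrite EC => -[].
have nDy : ~ D y by move=> Dy; apply: nEy; rewrite ED.
have [i|z clz] := scV 2 (fun i => if i == ord0 then P else Q) isT.
  case: eqP => _; split=> //.
    by exists (exist _ x (mem_set Vx)).
  by exists (exist _ y (mem_set Vy)).
have := clz ord0 I; have := clz ord_max I => /= clQ clP.
have [Dz|nDz] := pselect (D (set_val z)).
  have Ez : E (set_val z) by rewrite ED; split=> //; apply: set_mem (valP z).
  have Cz : C (set_val z) by move: Ez; rewrite EC => -[].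
  have [|w [nDw Cw]] := clQ P; first exact: open_nbhs_nbhs.
  apply: nDw; suff : E (set_val w) by rewrite ED => -[].
  by rewrite EC; split=> //; apply: set_mem (valP w).
have [|w [Cw nDw]] := clP Q; first exact: open_nbhs_nbhs.
apply: nDw; suff : E (set_val w) by rewrite ED => -[].
by rewrite EC; split=> //; apply: set_mem (valP w).
Qed.

Lemma nbhs_set_type (X : topologicalType) (A : set X) (x : set_type A)
    (U : set (set_type A)) :
  nbhs x U <-> exists2 W, nbhs (set_val x) W & set_val @^-1` W `<=` U.
Proof.
split=> [|[W nW WU]].
  rewrite nbhsE => -[_ [[C oC <-] Cx] CU]; exists C => //.
  by exists C.
by apply: filterS WU _; exact: (@initial_continuous _ _ set_val x).
Qed.

(** * Neighbourhoods in the Golomb-Kirch topology *)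

Section GolombKirch.
Variables (B : golomb_system) (kap : kirch_function B).
Local Notation Z := (golomb_kirch_space kap).

Definition good (p : nat) (x : int) : bool :=
  residue_class (p ^ gamma B p) x \notin base B p.

Lemma golomb_set_good (p r : nat) (x : int) : prime p -> gamma B p <= r ->
  (residue_class (p ^ r) x \notin golomb_set (base B) (p ^ r)) = good p x.
Proof.
move=> pp gr; have p0 k : 0 < p ^ k by rewrite expn_gt0 prime_gt0.
rewrite golomb_set_primary //; last exact: base_neq0.
by rewrite /primary_set gr inE residue_proj_class // dvdn_exp2l.
Qed.

Lemma good_congr (p r : nat) (x y : int) : gamma B p <= r ->
  (x = y %[mod (p ^ r)%N])%Z -> good p x = good p y.
Proof.
move=> gr xy; rewrite /good (@residue_class_eq _ x y) //.
by apply: modz_eq_dvd xy; rewrite dvdn_exp2l.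
Qed.

Lemma exists_bad (p : nat) : prime p -> exists b : int, ~~ good p b.
Proof.
move=> pp; have /set0Pn[b bB] := base_neq0 B pp.
exists (Posz (val b)); rewrite negbK residue_class_val //.
by rewrite expn_gt0 prime_gt0.
Qed.

Lemma open_coset (p r : nat) (x : int) : prime p -> gamma B p <= r ->
  le_natbar r (kap p) -> good p x -> open (coset x (p ^ r) : set Z).
Proof.
move=> pp gr rk gx.
have S : golomb_kirch_subbase kap (coset x (p ^ r)).
  by exists x, p, r; split=> //; rewrite golomb_set_good.
exists [set (coset x (p ^ r) : set Z)]; last by rewrite bigcup_set1.
move=> _ ->; exists [fset (coset x (p ^ r) : set Z)]%fset.
  by move=> U; rewrite in_fset1 => /eqP ->; exact: mem_set.
apply/seteqP; split=> [y|y xy i] /=; last by rewrite in_fset1 => /eqP->.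
by apply; rewrite /= in_fset1.
Qed.

Lemma nbhs_coset (p r : nat) (x : int) : prime p -> gamma B p <= r ->
  le_natbar r (kap p) -> good p x -> nbhs (x : Z) (coset x (p ^ r)).
Proof.
by move=> *; apply: open_nbhs_nbhs; split; [exact: open_coset|exact/cosetP].
Qed.

(** A subbasic coset containing [x] can be recentred at [x], and goodness depends only on the class
    modulo [p ^ gamma B p]; so the cosets of [x] at good primes generate its neighbourhood
    filter. *)
Lemma nbhs_sub_filter (x : int) (F : set_system Z) : Filter F ->
  (forall p r, prime p -> gamma B p <= r -> le_natbar r (kap p) -> good p x ->
     F (coset x (p ^ r))) ->
  nbhs (x : Z) `<=` F.
Proof.
move=> FF FS U; rewrite nbhsE => -[O [[D sD <-] [_ /[dup] /sD [E sE <-] DA xA]]] OU.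
apply: filterS OU _; apply: filterS (bigcup_sup DA) _.
apply: filter_bigI => V VE; have := xA V VE.
have /set_mem[a [p [r [pp gr rk + VaE]]]] := sE V VE; rewrite {}VaE => + xa.
rewrite golomb_set_good // => ga; have /cosetP xaE := xa.
have -> : coset a (p ^ r) = coset x (p ^ r).
  by apply/seteqP; split=> y /cosetP yE; apply/cosetP; rewrite yE.
by apply: FS => //; rewrite (good_congr gr xaE).
Qed.

(** The sets containing a full class of [x] form a filter: two classes of [x] share its class modulo
    the product of the moduli. *)
Lemma nbhs_coset_sub (x : int) (U : set Z) : nbhs (x : Z) U ->
  exists2 n, 0 < n & coset x n `<=` U.
Proof.
pose F : set_system Z := [set U | exists2 n, 0 < n & coset x n `<=` U].
apply: (@nbhs_sub_filter x F).
- split.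
  + by exists 1.
  + move=> P Q [m m0 mP] [n n0 nQ]; exists (m * n); first by rewrite muln_gt0 m0.
    move=> y /cosetP yx; split; [apply: mP|apply: nQ]; apply/cosetP.
      exact: modz_eq_dvd (dvdn_mulr _ _) yx.
    exact: modz_eq_dvd (dvdn_mull _ _) yx.
  + by move=> P Q PQ [n n0 nP]; exists n => //; exact: subset_trans PQ.
- by move=> p r pp _ _ _; exists (p ^ r) => //; rewrite expn_gt0 prime_gt0.
Qed.

(** [X] with [f] stands for both the integers and the positive integers: it
    carries the topology induced by [f], whose range contains all [y > 0]. *)
Section Induced.
Variables (X : topologicalType) (f : X -> Z).
Hypothesis nbhs_f : forall x U,
  nbhs x U <-> exists2 W, nbhs (f x) W & f @^-1` W `<=` U.
Hypothesis f_pos : forall y : int, (0 < y)%R -> exists x, f x = y.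

Lemma induced_continuous : continuous f.
Proof. by move=> x W nW; apply/nbhs_f; exists W. Qed.

(** * Local connectedness forces finite exponents *)

Lemma locally_connected_kappa : locally_connected X ->
  forall p, prime p -> kap p <> None.
Proof.
move=> lcX p pp kp.
have rk r : le_natbar r (kap p) by rewrite kp.
have g0 : 0 < gamma B p.
  by rewrite lt0n; apply/eqP => g0; rewrite (kappa_eq0 kap pp g0) in kp.
have p0 k : 0 < p ^ k by rewrite expn_gt0 prime_gt0.
have [b gb] : exists b, b \notin base B p.
  apply: contrapT => nb; move: (base_neqT pp g0); apply/negP/negPn.
  apply/eqP/setP => b; rewrite inE; apply: contrapT => /negP bB.
  by apply: nb; exists b.
have [y y0 yb] := crt_primes (fun=> Posz (val b)) (gamma B) p.+1.
have gy : good p y.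
  by rewrite /good (residue_class_eq (yb p _ pp)) // residue_class_val.
have [x fx] := f_pos y0.
have [V [oV Vx VU clV]] : exists V, [/\ open V, V x,
    V `<=` f @^-1` coset y (p ^ gamma B p) & connected V].
  by apply: lcX; apply: induced_continuous; rewrite fx; exact: nbhs_coset.
have nV : nbhs x V by exact: open_nbhs_nbhs.
have [W] := (nbhs_f _ _).1 nV; rewrite fx => nW WV.
have [n n0 nWs] := nbhs_coset_sub nW.
have [z fz] : exists z, f z = (y + n%:Z)%R by apply: f_pos; rewrite ltr_wpDr.
have Vz : V z by apply: WV; apply: nWs; rewrite fz; exists 1%R; rewrite mulr1.
(* The summand [gamma B p] makes the classes modulo [p ^ s] open near [y]; the summand [n] gives
   [n < p ^ s], which separates [y] from [y + n]. *)
pose s := gamma B p + n.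
have open_class k a : coset y (p ^ gamma B p) a -> gamma B p <= k ->
    open (f @^-1` coset a (p ^ k)).
  move=> /cosetP ay gk; apply: open_comp => [u _|]; first exact: induced_continuous.
  by apply: open_coset; rewrite // (good_congr (leqnn _) ay).
have yy : coset y (p ^ gamma B p) y by exact/cosetP.
have /seteqP[_] : V `&` f @^-1` coset y (p ^ s) = V.
  apply: clV.
  - by exists x; split=> //; rewrite /= fx; exact/cosetP.
  - by exists (f @^-1` coset y (p ^ s)) => //; apply: open_class => //; exact: leq_addr.
  (* The other classes modulo [p ^ s] inside the class of [y] modulo [p ^ gamma B p] are good at [p]
     as well, so their union is open. *)
  - exists (~` (\bigcup_(a in coset y (p ^ gamma B p) `\` coset y (p ^ s))
                f @^-1` coset a (p ^ s))).
      apply: open_closedC; apply: bigcup_open => a [ay _].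
      by apply: open_class => //; exact: leq_addr.
    apply/seteqP; split=> u [Vu].
      move=> /= /cosetP uy; split=> // -[a [_ nay] /cosetP ua].
      by apply: nay; apply/cosetP; rewrite -ua.
    move=> nu; split=> //; apply: contrapT => nuy; apply: nu.
    by exists (f u); [split=> //; exact: VU | exact/cosetP].
move=> /(_ z Vz) [_] /=; rewrite fz => /cosetP /eqP.
rewrite eqz_mod_dvd [(y + _)%R]addrC addrK dvdzE /= => /(dvdn_leq n0).
apply/negP; rewrite -ltnNge; apply: leq_trans (ltn_expl n (prime_gt1 pp)) _.
by rewrite leq_exp2l ?prime_gt1 // leq_addl.
Qed.

(** * Finite exponents give local superconnectedness *)

Hypothesis kap_fin : forall p, prime p -> kap p <> None.

(** The default [0] is never reached at a prime, by [kap_fin]. *)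
Let K p := odflt 0 (kap p).

Let gamma_le_K p : prime p -> gamma B p <= K p.
Proof.
move=> pp; have := kap_fin pp; have := gamma_le_kappa kap pp.
by rewrite /K; case: (kap p).
Qed.

Let core (x : int) (N : nat) : set Z :=
  [set y : int | forall p, p < N -> prime p -> good p x ->
                   (y = x %[mod (p ^ K p)%N])%Z].

Let le_natbar_K r p : prime p -> le_natbar r (kap p) = (r <= K p).
Proof. by move=> pp; have := kap_fin pp; rewrite /K; case: (kap p). Qed.

Let core_id x N : core x N x. Proof. by []. Qed.

Let core_sub x N M : N <= M -> core x M `<=` core x N.
Proof. by move=> NM y xy p pN; apply: xy; exact: leq_trans NM. Qed.

Let open_core x N : open (core x N).
Proof.
have -> : core x N = \bigcap_(p in [set p | p < N /\ prime p /\ good p x])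
    (coset x (p ^ K p) : set Z).
  apply/seteqP; split=> [y xy p [pN [pp gp]]|y xy p pN pp gp].
    by apply/cosetP; exact: xy.
  by apply/cosetP; exact: xy.
have -> : [set p | p < N /\ prime p /\ good p x] =
    [set` [seq p <- iota 0 N | prime p && good p x]].
  apply/seteqP; split=> p /=; rewrite mem_filter mem_iota /=.
    by move=> [-> [-> ->]].
  by move=> /andP[/andP[-> ->] ->].
rewrite bigcap_seq big_seq_cond.
apply: (big_ind (fun U : set Z => open U)); [exact: openT|exact: openI|move=> p].
rewrite mem_filter andbT => /andP[/andP[pp gp] _].
by apply: open_coset => //; [exact: gamma_le_K|rewrite le_natbar_K].
Qed.

(** The exponent [K p] is the largest allowed, so the coset of [x] modulo [p ^ K p] lies in every
    generating coset at [p]. *)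
Let nbhs_core x (U : set Z) : nbhs (x : Z) U -> exists N, core x N `<=` U.
Proof.
pose F : set_system Z := [set U | exists N, core x N `<=` U].
apply: (@nbhs_sub_filter x F).
- split.
  + by exists 0.
  + move=> P Q [m mP] [n nQ]; exists (maxn m n) => y xy.
    split; [apply: mP|apply: nQ]; apply: core_sub xy.
      exact: leq_maxl.
    exact: leq_maxr.
  + by move=> P Q PQ [n nP]; exists n; exact: subset_trans PQ.
- move=> p r pp _ + gp; rewrite le_natbar_K // => rK.
  exists p.+1 => y xy; apply/cosetP.
  by apply: modz_eq_dvd (xy p _ pp gp); rewrite // dvdn_exp2l.
Qed.

Let superconnected_core x N : superconnected (set_type (f @^-1` core x N)).
Proof.
move=> r U r0 oU.
have nbhs_U (u : set_type (f @^-1` core x N)) W : nbhs u W ->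
    exists M, forall v, core (f (set_val u)) M (f (set_val v)) -> W v.
  move=> /nbhs_set_type [W1 /nbhs_f[W2 /nbhs_core[M MW2] W21] W1W].
  by exists M => v uv; apply: W1W; apply: W21; exact: MW2.
(* Each pair is a centre in [U i] and a bound on the primes constraining it. *)
have /choice[a Ha] : forall i, exists aM : int * nat, core x N aM.1 /\
    forall v : set_type (f @^-1` core x N), core aM.1 aM.2 (f (set_val v)) -> U i v.
  move=> i; have [oUi [u Uu]] := oU i.
  have [|M HM] := nbhs_U u (U i); first exact: open_nbhs_nbhs.
  by exists (f (set_val u), M); split=> //; exact: set_mem (valP u).
have /choice[b Hb] : forall p, exists b, prime p -> ~~ good p b.
  move=> p; have [/exists_bad[b pb]|] := boolP (prime p); first by exists b.
  by exists 0%R.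
pose M := maxn N (\max_i (a i).2).
have aM i : (a i).2 <= M by apply: leq_trans (leq_maxr _ _); exact: leq_bigmax.
(* The common closure point agrees with [x] where [core x N] demands it and is bad at all other
   primes below [M]. *)
pose c p := if (p < N) && good p x then x else b p.
have [y y0 yc] := crt_primes c K M.
have [y' fy'] := f_pos y0.
have xy : core x N y.
  move=> p pN pp gx; rewrite yc //; last by apply: leq_trans pN _; exact: leq_maxl.
  by rewrite /c pN gx.
have [v fv] : exists v : set_type (f @^-1` core x N), f (set_val v) = y.
  have Vy' : (f @^-1` core x N) y' by rewrite /= fy'.
  by exists (exist _ y' (mem_set Vy')).
exists v => i _ W /nbhs_U[L HL].
have [xai Hai] := Ha i; set ai := (a i).1 in xai Hai; set Mi := (a i).2 in Hai.
(* The point [z] must satisfy the constraints of [x], of [ai] and of [y]. Those of [x] come first,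
   since [ai] and [y] both lie in [core x N] and agree with [x] there. *)
pose d p := if (p < N) && good p x then x else
            if (p < Mi) && good p ai then ai else y.
have [z z0 zd] := crt_primes d K (maxn N (maxn Mi L)).
have zdE p : (p < N) || ((p < Mi) || (p < L)) -> prime p ->
    (z = d p %[mod (p ^ K p)%N])%Z.
  by move=> pNML; apply: zd; rewrite !leq_max.
have xz : core x N z by move=> p pN pp gx; rewrite zdE ?pN // /d pN gx.
have [z' fz'] := f_pos z0.
have [w fw] : exists w : set_type (f @^-1` core x N), f (set_val w) = z.
  have Vz' : (f @^-1` core x N) z' by rewrite /= fz'.
  by exists (exist _ z' (mem_set Vz')).
exists w; split.
  apply: Hai; rewrite fw => p pMi pp gai; rewrite zdE ?pMi ?orbT // /d pMi gai.
  by case: ifP => // /andP[pN gx]; rewrite xai.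
apply: HL; rewrite fv fw => p pL pp gy; rewrite zdE ?pL ?orbT // /d.
case: ifP => [/andP[pN gx]|xF]; first by rewrite xy.
case: ifP => // /andP[pMi gai].
(* Such a [p] is bad at [y] by the choice of [y]. *)
have yb : (y = b p %[mod (p ^ K p)%N])%Z.
  by rewrite yc ?(leq_trans pMi (aM i)) // /c xF.
by move: (Hb p pp); rewrite -(good_congr (gamma_le_K pp) yb) gy.
Qed.

Lemma kappa_locally_superconnected : locally_superconnected X.
Proof.
move=> x U /nbhs_f[W /nbhs_core[N NW] WU].
exists (f @^-1` core (f x) N); split.
- by apply: open_comp (open_core _ _) => u _; exact: induced_continuous.
- exact: core_id.
- by move=> u xu; apply: WU; exact: NW.
- exact: superconnected_core.
Qed.

End Induced.
End GolombKirch.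

Lemma locally_superconnected_connected (X : topologicalType) :
  locally_superconnected X -> locally_connected X.
Proof.
move=> lsX x U /lsX[V [oV Vx VU scV]].
by exists V; split=> //; exact: superconnected_connected.
Qed.

Theorem theorem2p37 (B : golomb_system) (kap : kirch_function B) :
  [/\ locally_connected (golomb_kirch_space kap) <->
        (forall p : nat, prime p -> kap p <> None),
      locally_connected (set_type (positive_part kap)) <->
        (forall p : nat, prime p -> kap p <> None) &
      (forall p : nat, prime p -> kap p <> None) ->
        locally_superconnected (golomb_kirch_space kap) /\
        locally_superconnected (set_type (positive_part kap))].
Proof.
have nbhs_id (x : golomb_kirch_space kap) U :
    nbhs x U <-> exists2 W, nbhs (id x) W & id @^-1` W `<=` U.
  by split=> [nU|[W nW WU]]; [exists U|exact: filterS nW].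
have id_pos (y : int) : (0 < y)%R ->
    exists x : golomb_kirch_space kap, id x = y by exists y.
have val_pos (y : int) : (0 < y)%R ->
    exists x : set_type (positive_part kap), set_val x = y.
  by move=> y0; exists (exist _ (y : golomb_kirch_space kap) (mem_set y0)).
have nbhs_val := @nbhs_set_type _ (positive_part kap).
split.
- split; first exact: locally_connected_kappa nbhs_id id_pos.
  move=> kfin; apply: locally_superconnected_connected.
  exact: kappa_locally_superconnected nbhs_id id_pos kfin.
- split; first exact: locally_connected_kappa nbhs_val val_pos.
  move=> kfin; apply: locally_superconnected_connected.
  exact: kappa_locally_superconnected nbhs_val val_pos kfin.
- move=> kfin; split.
    exact: kappa_locally_superconnected nbhs_id id_pos kfin.
  exact: kappa_locally_superconnected nbhs_val val_pos kfin.
Qed.
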